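(* Let $d \in \{0,1,\dots,9\}$ be a decimal digit and let $(T_n)_{n\ge 0}$ be the look-and-say-again sequence of seed $T_0 = d$. Then for every $n \ge 0$, every digit occurring in $T_n$ belongs to $\{1,2,4,6,d\}$.
   Context: Numbers are written in base 10 and identified with finite words over the digits $\{0,1,\dots,9\}$. Juxtaposition $ab$ denotes concatenation, and $a^b$ denotes the digit $a$ repeated $b$ times. Every nonempty word $T$ can be written uniquely as $T = a_1^{n_1} a_2^{n_2}\cdots a_k^{n_k}$ with digits $a_i$, integers $n_i \ge 1$, and $a_i \ne a_{i+1}$ for all $1 \le i < k$. This is its run-length representation, i.e. its decomposition into maximal blocks of equal digits. The look-and-say-again sequence of seed $d$ is the sequence of words $(T_n)_{n\ge0}$ defined by $T_0 = d$ (a single decimal digit) and, if $T_n$ has run-length representation $a_1^{n_1}a_2^{n_2}\cdots a_k^{n_k}$, then $$T_{n+1} = n_1 n_1 a_1 a_1\, n_2 n_2 a_2 a_2 \cdots n_k n_k a_k a_k$$ (concatenation, each $n_i$ being written in base 10). For example, seed $1$ gives $1 \to 1111 \to 4411 \to 22442211 \to \cdots$. *)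

(* Defs.v *)
From mathcomp Require Import all_boot.

Set Implicit Arguments.
Unset Strict Implicit.
Unset Printing Implicit Defensive.

Definition digit := 'I_10.
Definition word := seq digit.

(* The fuel of [decimal_rec] bounds the number of digits; [n.+1] is enough. *)
Fixpoint decimal_rec (fuel n : nat) : word :=
  if fuel is fuel'.+1 then
    if n < 10 then [:: inord n]
    else rcons (decimal_rec fuel' (n %/ 10)) (inord (n %% 10))
  else [::].

(* Most significant digit first, no leading zero. *)
Definition decimal (n : nat) : word := decimal_rec n.+1 n.

(* Maximal blocks of equal letters, from left to right, as pairs
   (length, letter). *)
Fixpoint runs (w : word) : seq (nat * digit) :=
  if w is a :: w' then
    match runs w' with
    | (n, b) :: r => if a == b then (n.+1, b) :: r else (1, a) :: (n, b) :: r
    | [::] => [:: (1, a)]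
    end
  else [::].

Definition say_again (w : word) : word :=
  flatten [seq decimal r.1 ++ decimal r.1 ++ [:: r.2; r.2] | r <- runs w].

Definition look_and_say_again (d : digit) (n : nat) : word :=
  iter n say_again [:: d].

Lemma decimalP (n : nat) :
  foldl (fun m (x : digit) => 10 * m + x) 0 (decimal n) = n /\
  (0 < n -> head ord0 (decimal n) != ord0).
Proof.
rewrite /decimal; suff H f : n < f ->
  [/\ foldl (fun m (x : digit) => 10 * m + x) 0 (decimal_rec f n) = n,
      0 < size (decimal_rec f n) &
      0 < n -> head ord0 (decimal_rec f n) != ord0] by case: (H n.+1).
elim: f n => // f IHf n ltnf /=; case: ltnP => [n10|n10].
  by rewrite /= inordK // muln0 add0n; split=> // n0; rewrite -val_eqE /= inordK // -lt0n.
have q0 : 0 < n %/ 10 by rewrite divn_gt0.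
have [|v s h] := IHf (n %/ 10).
  by rewrite (leq_trans (ltn_Pdiv _ _)) // (leq_trans _ n10).
rewrite foldl_rcons v inordK ?ltn_pmod // mulnC -divn_eq size_rcons; split=> // _.
by case: (decimal_rec _ _) s (h q0).
Qed.

Lemma runsP (w : word) :
  [/\ flatten [seq nseq r.1 r.2 | r <- runs w] = w,
      all (fun r => 0 < r.1) (runs w) &
      sorted (fun r s => r.2 != s.2) (runs w)].
Proof.
elim: w => //= a w [f p s].
case: (runs w) f p s => [|[n b] r] /= f p s; first by rewrite -f.
have [->|ab] := eqVneq a b; rewrite /= -f; split=> //.
- by case/andP: p.
- by case: r s {f p}.
- by rewrite ab.
Qed.

(* Main.v *)
Require Import Defs.
From mathcomp Require Import all_boot.

(** From the first step on, every word is the letterwise doubling of a word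
    [m_1 a_1 m_2 a_2 ...] whose letters of even rank satisfy [a_i != a_(i+1)].
    Four consecutive letters contain two consecutive [a_i], so the runs of this
    halved word have length at most 3. The runs of the doubled word then have
    length 2, 4 or 6, which are the only digits that the next step can add. *)

Definition double_word (u : word) : word := flatten [seq [:: a; a] | a <- u].

Definition interleave (s : seq (digit * digit)) : word :=
  flatten [seq [:: p.1; p.2] | p <- s].

Lemma decimal_digit n : n < 10 -> decimal n = [:: inord n].
Proof. by rewrite /decimal /= => ->. Qed.

Lemma runs_double_word u :
  runs (double_word u) = [seq (r.1.*2, r.2) | r <- runs u].
Proof.
elim: u => //= a u; rewrite -/(double_word u) => ->.
case: (runs u) => [|[n b] r] /=; first by rewrite eqxx.
by have [->|_] := eqVneq a b; rewrite /= eqxx.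
Qed.

Lemma mem_runs u r : r \in runs u -> 0 < r.1 /\ r.2 \in u.
Proof.
have [f p _] := runsP u => ur; have r0 := allP p _ ur; split=> //.
by rewrite -f; apply/flatten_mapP; exists r; rewrite // mem_nseq r0 eqxx.
Qed.

(** The leading run is bounded by 2 rather than 3 to leave room for one more letter in front. In the
    induction, a letter [c] equal to [b] may lengthen the run of [b] to 3, but then [a != b] closes
    it; if [c != b], the leading run is at most [a c]. *)
Lemma runs_cons_interleave a s :
  path (fun b c => b != c) a (unzip2 s) ->
  exists k r, [/\ runs (a :: interleave s) = (k, a) :: r, k <= 2
                & all (fun q => q.1 <= 3) r].
Proof.
elim: s a => [|[c b] s IHs] a /=; first by exists 1, [::].
case/andP=> ab /IHs [k [r [/= -> k2 r3]]].
have k3 := leqW k2.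
have [_|_] := eqVneq c b.
  by rewrite (negPf ab); exists 1, ((k.+1, b) :: r); split=> //=; rewrite ltnS k2.
have [->|ac] := eqVneq a c; first by exists 2, ((k, b) :: r); rewrite /= k3.
by exists 1, ((1, c) :: (k, b) :: r); rewrite /= k3.
Qed.

Lemma runs_interleave_le3 s :
  sorted (fun b c => b != c) (unzip2 s) ->
  all (fun q => q.1 <= 3) (runs (interleave s)).
Proof.
case: s => //= -[c b] s /= /runs_cons_interleave [k [r [/= -> k2 r3]]].
by have [_|_] := eqVneq c b; rewrite /= ?ltnS ?k2 ?(leqW k2).
Qed.

(** Runs of the doubled word have length at most 6, so each length is a single digit [m], and the
    block [m m a a] is the doubling of [m a]. *)
Lemma say_again_double_word u :
  all (fun q => q.1 <= 3) (runs u) ->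
  say_again (double_word u) =
  double_word (interleave [seq (inord r.1.*2, r.2) | r <- runs u]).
Proof.
rewrite /say_again runs_double_word -map_comp.
elim: (runs u) => //= -[n a] r IHr /andP[/= n3 /IHr ->].
by rewrite decimal_digit // -[10]/(5.*2) ltn_double (leq_ltn_trans n3).
Qed.

Lemma look_and_say_again_double d n :
  exists u, [/\ look_and_say_again d n.+1 = double_word u,
    all (fun q => q.1 <= 3) (runs u)
    & {in u, forall x, nat_of_ord x \in [:: 1; 2; 4; 6; nat_of_ord d]}].
Proof.
elim: n => [|n [u [Tu u3 uS]]].
  (* The first step gives [11dd], the doubling of [1d]. *)
  exists (interleave [:: (inord 1, d)]); split.
  - by [].
  - exact: runs_interleave_le3.
  - by move=> x; rewrite !inE => /orP[]/eqP->; rewrite ?inordK ?eqxx ?orbT.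
exists (interleave [seq (inord r.1.*2, r.2) | r <- runs u]); split.
- by rewrite -say_again_double_word // -Tu.
(* The letters of even rank are those of successive maximal runs, hence differ. *)
- apply: runs_interleave_le3; rewrite /unzip2 -map_comp sorted_map.
  by have [_ _] := runsP u.
- move=> x /flatten_mapP [_ /mapP [[k a] ur ->]] /=.
  have [/= k0 au] := mem_runs _ _ ur; have /= k3 := allP u3 _ ur.
  rewrite in_cons mem_seq1 => /orP[]/eqP-> {x}; last exact: uS.
  (* Run lengths 1, 2, 3 of [u] yield the digits 2, 4, 6. *)
  by case: k k0 k3 {ur} => [|[|[|[|]]]] //= _ _; rewrite inordK.
Qed.

Theorem theorem1 (d : 'I_10) (n : nat) (x : 'I_10) :
  x \in look_and_say_again d n ->
  nat_of_ord x \in [:: 1; 2; 4; 6; nat_of_ord d].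
Proof.
(* The seed is a single letter, not a doubling, so it is treated apart. *)
case: n => [|n]; first by rewrite mem_seq1 => /eqP->; rewrite !inE eqxx !orbT.
have [u [-> _ uS]] := look_and_say_again_double d n.
by case/flatten_mapP=> y /uS yS; rewrite !in_cons orbF orbb => /eqP->.
Qed.
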